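(* There is a non-separable growth $K$ of $\omega$ which supports a measure and which can be mapped continuously onto $[0,1]^{\mathfrak{c}}$.
   Context: The result is in ZFC. $\mathfrak{c}$ is the cardinality of the continuum. A compactification of $\omega$ (with the discrete topology) is a compact (Hausdorff) space $L\supseteq\omega$ in which $\omega$ is a dense (discrete) subspace; a growth of $\omega$ is a space of the form $L\setminus\omega$, where $L$ is a compactification of $\omega$. A compact space $K$ supports a measure if there is a (finite Radon) measure $\mu$ on $K$ with $\mu(U)>0$ for every nonempty open $U\subseteq K$. *)

(* Defs.v *)
From HB Require Import structures.
From mathcomp Require Import all_boot all_order all_algebra.
From mathcomp Require Import all_classical all_reals all_analysis.
Import numFieldNormedType.Exports.

Set Implicit Arguments.
Unset Strict Implicit.
Unset Printing Implicit Defensive.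

Local Open Scope classical_set_scope.
Local Open Scope ring_scope.

Definition embedding (X Y : topologicalType) (f : X -> Y) : Prop :=
  injective f /\
  forall U : set X, open U <-> exists2 V : set Y, open V & f @^-1` V = U.

(* [nat] carries the discrete topology, so that [embedding i] says that [i]
   identifies omega with a discrete subspace of [L]. *)
Definition compactification_of_omega (L : topologicalType) (i : nat -> L)
    : Prop :=
  [/\ compact [set: L], hausdorff_space L, embedding i & dense (range i)].

(* [K] is homeomorphic to the subspace [L \ omega] of some compactification [L]
   of omega. We ask for a copy rather than for the subtype itself because the
   carrier of a Borel structure has to be pointed. *)
Definition growth_of_omega (K : topologicalType) : Prop :=
  exists (L : topologicalType) (i : nat -> L) (e : K -> L),
    [/\ compactification_of_omega i, embedding e & range e = ~` range i].

Definition separable (X : topologicalType) : Prop :=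
  exists2 D : set X, countable D & dense D.

Notation borelType K := (g_sigma_algebraType (@open K)).

(* For a finite Borel measure, Radon means inner regular with respect to
   compact sets. *)
Definition radon (R : realType) (K : ptopologicalType)
    (mu : {finite_measure set (borelType K) -> \bar R}) : Prop :=
  forall B : set (borelType K), measurable B ->
    mu B = ereal_sup [set mu C | C in [set C : set K | compact C /\ C `<=` B]].

Definition supports_measure (R : realType) (K : ptopologicalType) : Prop :=
  exists2 mu : {finite_measure set (borelType K) -> \bar R},
    radon mu & forall U : set K, open U -> U !=set0 -> (0 < mu U)%E.

(* [0,1]^c, with the product topology, the continuum c being the cardinality of
   [R]. *)
Definition unit_cube (R : realType) : topologicalType :=
  {ptws R -> set_type (`[0, 1]%classic : set R)}.

(* Main.v *)
(* Let Omega be the countable set of nodes (n, s), where s consists of an n x n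
   bit matrix and of one further bit for every 0-1 string of length n.  For
   f : nat -> nat -> bool let T_f be the set of nodes (n, s) such that no row i
   of s agrees with f on its first i + 1 entries, and for c : nat -> bool let
   B_c be the set of nodes (n, s) whose bit at the string c|n is 1.  The points
   of Omega, the T_f and the B_c generate a Boolean algebra of subsets of Omega;
   the growth K is the set of free ultrafilters of this algebra.

   An ultrafilter limit of the counting densities on the levels is a finitely
   additive measure on P(Omega) that vanishes on finite sets, hence induces a
   Radon measure on K.  It is strictly positive: if an element of the algebra
   contains nodes of arbitrarily large level, take one of large level N; among
   its extensions the bits B_c are independent, and the T_f are left with
   probability at most k * sum_(i >= N) 2^-(i+1) = k * 2^-N.

   K is not separable: finitely many f exhaust all patterns of row k, so every
   x in K has a pattern r_k on row k such that T_f is not in x whenever f has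
   row r_k.  Diagonalizing against x_0, x_1, ... yields f such that T_f belongs
   to no x_k.  Finally, the B_c are independent and there are continuum many of
   them, so K maps onto 2^c and hence onto [0,1]^c. *)
Require Import Defs.
From HB Require Import structures.
From mathcomp Require Import all_boot all_order all_algebra.
From mathcomp Require Import all_classical all_reals all_analysis.
From mathcomp Require Import ring lra.
Import numFieldNormedType.Exports.
Import Order.TTheory GRing.Theory Num.Theory.

Set Implicit Arguments.
Unset Strict Implicit.
Unset Printing Implicit Defensive.

Local Open Scope classical_set_scope.
Local Open Scope ring_scope.

(** * Radon measures from finitely additive measures *)

(* In the application [X] is the dense discrete subset of a compactification,
   [T] the remainder, and [hat C] the trace on [T] of the closure of [C]. *)
Section RadonExtension.
Context (R : realType) (T : ptopologicalType) (X : choiceType).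
Variables (m : set X -> R) (hat : set X -> set T).

Hypothesis T_compact : compact [set: T].
Hypothesis hat_closed : forall C, closed (hat C).
Hypothesis hat0 : hat set0 = set0.
Hypothesis hatU : {morph hat : C D / C `|` D}.
Hypothesis hat_base : forall (U : set T) p, open U -> U p ->
  exists2 W, ~ hat (~` W) p & hat W `<=` U.
Hypothesis m_ge0 : forall C, 0 <= m C.
Hypothesis mU : forall C D, [disjoint C & D] -> m (C `|` D) = m C + m D.
Hypothesis m_hat0 : forall C, hat C = set0 -> m C = 0.

Local Lemma hatS C D : C `<=` D -> hat C `<=` hat D.
Proof. by move=> /setUidPr <-; rewrite hatU; exact: subsetUl. Qed.

Local Lemma mS C D : C `<=` D -> m C <= m D.
Proof.
move=> /setDUK <-; rewrite mU ?lerDl//; apply/eqP; exact: setDIK.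
Qed.

Local Lemma mU_le C D : m (C `|` D) <= m C + m D.
Proof.
rewrite -[X in m X <= _](setDUK (@subsetUl _ C D)) mU; last first.
  by apply/eqP; exact: setDIK.
by rewrite lerD2l; apply: mS; rewrite setDUl setDv set0U; exact: subDsetl.
Qed.

(** As in the Riesz construction, open sets are measured from inside by the sets [hat C], and
    arbitrary sets from outside by open sets. *)
Definition open_content (U : set T) : \bar R :=
  ereal_sup [set (m C)%:E | C in [set C | hat C `<=` U]].

Definition outer_content (A : set T) : \bar R :=
  ereal_inf [set open_content U | U in [set U | open U /\ A `<=` U]].

Local Open Scope ereal_scope.

Local Lemma open_content_ub C U : hat C `<=` U -> (m C)%:E <= open_content U.
Proof. by move=> CU; apply: ereal_sup_ubound; exists C. Qed.

Local Lemma open_content_ge0 U : 0 <= open_content U.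
Proof.
apply: le_trans (open_content_ub (C := set0) _); first by rewrite lee_fin.
by rewrite hat0.
Qed.

Local Lemma open_contentS U V : U `<=` V -> open_content U <= open_content V.
Proof.
move=> UV; apply: ge_ereal_sup => _ [C CU <-]; apply: open_content_ub.
exact: subset_trans CU UV.
Qed.

Local Lemma open_contentT U : open_content U <= (m setT)%:E.
Proof. by apply: ge_ereal_sup => _ [C CU <-]; rewrite lee_fin; exact: mS. Qed.

Local Lemma open_content0 : open_content set0 = 0.
Proof.
apply/eqP; rewrite eq_le open_content_ge0 andbT.
apply: ge_ereal_sup => _ [C C0 <-].
by rewrite m_hat0//; apply/seteqP; split.
Qed.

Local Lemma outer_contentE U : open U -> outer_content U = open_content U.
Proof.
move=> oU; apply/eqP; rewrite eq_le; apply/andP; split.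
  by apply: ereal_inf_lbound; exists U => //; split.
by apply: le_ereal_inf_tmp => _ [V [_ UV] <-]; exact: open_contentS.
Qed.


Local Lemma hat_compact C : compact (hat C).
Proof.
by apply: (subclosed_compact (@hat_closed C) T_compact); exact: subsetT.
Qed.

Local Lemma hat_bigsetU (I : Type) (r : seq I) (P : pred I) (F : I -> set X) :
  hat (\big[setU/set0]_(i <- r | P i) F i) =
  \big[setU/set0]_(i <- r | P i) hat (F i).
Proof. exact: (big_morph hat hatU hat0). Qed.

(** By [hat_base], the complements of [hat (setC V)], for [V] with [hat V] inside some [U n], form
    an open cover of the compact [hat C]; a finite subcover is grouped by the index [n]. *)
Local Lemma hat_split (U : (set T)^nat) C : (forall n, open (U n)) ->
    hat C `<=` \bigcup_n U n ->
  exists N (W : (set X)^nat), (forall n, hat (W n) `<=` U n) /\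
    hat (C `\` \big[setU/set0]_(n < N) W n) = set0.
Proof.
move=> oU CU.
have := @hat_compact C; rewrite compact_cover => /(_ _
  [set nW : nat * set X | hat nW.2 `<=` U nW.1] (fun nW => ~` hat (~` nW.2))).
case=> [nW _| p Cp|D DU CD]; first exact/closed_openC/hat_closed.
  have [n _ Unp] := CU _ Cp; have [W Wp WU] := hat_base (oU n) Unp.
  by exists (n, W).
pose W n := \big[setU/set0]_(x <- finmap.enum_fset D | x.1 == n) x.2.
pose N := (\max_(x <- finmap.enum_fset D) x.1).+1.
exists N, W; split=> [n|].
  rewrite hat_bigsetU big_seq_cond; elim/big_ind: _ => //.
    by move=> A B An Bn p [/An|/Bn].
  by move=> x /andP[/DU/set_mem/= xU /eqP <-].
apply/seteqP; split=> // p pC.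
have {CD}[[n V] /= VD Vp] := CD _ (hatS (@subDsetl _ _ _) pC).
(* What is left of [C] misses the piece [V], whereas [Vp] keeps [p] out of [hat] of the complement
   of [V]. *)
apply: Vp; apply: hatS pC => s [_ sW] Vs; apply: sW.
rewrite -bigcup_mkord; exists n.
  rewrite /= ltnS.
  by apply: (leq_bigmax_seq (F := fun x : nat * set X => x.1)) VD _.
by rewrite /W -bigcup_seq_cond; exists (n, V) => //=; apply/andP.
Qed.

Local Lemma m_bigsetU N (W : (set X)^nat) :
  (m (\big[setU/set0]_(n < N) W n) <= \sum_(n < N) m (W n))%R.
Proof.
elim: N => [|N IH]; first by rewrite !big_ord0 m_hat0.
by rewrite !big_ord_recr/=; apply: le_trans (mU_le _ _) _; rewrite lerD2r.
Qed.

(** Compactness leaves finitely many pieces and a null rest, so finite subadditivity of [m]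
    suffices. *)
Local Lemma open_content_sigma_subadditive (U : (set T)^nat) :
    (forall n, open (U n)) ->
  open_content (\bigcup_n U n) <= \sum_(n <oo) open_content (U n).
Proof.
move=> oU; apply: ge_ereal_sup => _ [C CU <-].
have [N [W [WU C0]]] := hat_split oU CU.
apply: le_trans (nneseries_lim_ge N _); last first.
  by move=> *; exact: open_content_ge0.
rewrite big_mkord.
apply: (@le_trans _ _ (\sum_(n < N) (m (W n))%:E)); last first.
  by apply: lee_sum => n _; exact: open_content_ub.
rewrite sumEFin lee_fin; apply: le_trans (@m_bigsetU N W).
rewrite -[leRHS]addr0 -(m_hat0 C0); apply: le_trans (mU_le _ _).
apply: mS => s Cs; have [Ws|Ws] := pselect ((\big[setU/set0]_(n < N) W n) s).
  by left.
by right.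
Qed.

Local Lemma outer_content_ge0 A : 0 <= outer_content A.
Proof. by apply: le_ereal_inf_tmp => _ [U _ <-]; exact: open_content_ge0. Qed.

Local Lemma outer_contentS A B : A `<=` B -> outer_content A <= outer_content B.
Proof.
move=> AB; apply: ereal_inf_le_tmp => _ [U [oU BU] <-].
by exists U => //; split=> //; exact: subset_trans BU.
Qed.

Local Lemma outer_content_fin A : outer_content A \is a fin_num.
Proof.
rewrite ge0_fin_numE ?outer_content_ge0//.
apply: le_lt_trans (ltry (m setT)).
by apply: le_trans (outer_contentS (@subsetT _ A)) _;
  rewrite outer_contentE ?open_contentT//; exact: openT.
Qed.

Local Lemma outer_content0 : outer_content set0 = 0.
Proof. by rewrite outer_contentE ?open_content0//; exact: open0. Qed.

Local Lemma outer_content_adherent A (e : R) : (0 < e)%R ->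
  exists U, [/\ open U, A `<=` U & open_content U <= outer_content A + e%:E].
Proof.
move=> e0; have [_ [U [oU AU] <-] /ltW Ue] :=
  lb_ereal_inf_adherent e0 (outer_content_fin A).
by exists U.
Qed.

Local Lemma outer_content_sigma_subadditive : sigma_subadditive outer_content.
Proof.
move=> A; apply/lee_addgt0Pr => e e0.
have /choice[U AU] n := outer_content_adherent (A n)
  (divr_gt0 e0 (eqbRL (ltr0n R (2 ^ n.+1)) (expn_gt0 _ _))).
apply: le_trans (epsilon_trick xpredT _ (ltW e0)); last first.
  by move=> n; exact: outer_content_ge0.
have oU n : open (U n) by have [] := AU n.
apply: (@le_trans _ _ (outer_content (\bigcup_n U n))).
  by apply: outer_contentS; apply: subset_bigcup => n _; have [] := AU n.
rewrite outer_contentE; last by exact: bigcup_open.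
apply: le_trans (open_content_sigma_subadditive oU) _.
apply: lee_nneseries => [n _ _|n _]; first exact: open_content_ge0.
by have [] := AU n.
Qed.

HB.instance Definition _ := isOuterMeasure.Build R T outer_content
  outer_content0 outer_content_ge0 outer_contentS
  outer_content_sigma_subadditive.

(* If [hat C] lies in [V `&` U] and [hat D] in [V `\` hat C], then [C `&` D]
   is null and [C `\` D] and [D] together witness
   [open_content V >= m C + m D]. *)
Local Lemma open_caratheodory (U : set T) :
  open U -> outer_content.-caratheodory U.
Proof.
move=> oU; apply: (@le_caratheodory_measurable R T outer_content) => A.
apply: le_ereal_inf_tmp => _ [V [oV AV] <-].
apply: (@le_trans _ _ (open_content (V `&` U) + outer_content (V `&` ~` U))).
  rewrite -(outer_contentE (openI oV oU)).
  by apply: leeD; apply: outer_contentS; exact: setSI.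
rewrite -leeBrDr ?outer_content_fin//.
apply: ge_ereal_sup => _ [C CVU <-].
rewrite leeBrDr ?outer_content_fin// addeC -leeBrDr//.
(* The part of [V] outside [U] need not be open; it is enlarged to an open set, whose content is
   again a supremum. *)
apply: (@le_trans _ _ (open_content (V `&` ~` hat C))).
  rewrite -outer_contentE; last exact/openI/closed_openC/hat_closed.
  by apply: outer_contentS => p [Vp Up]; split=> // /CVU[].
apply: ge_ereal_sup => _ [D DV <-].
rewrite leeBrDr// -EFinD.
apply: (@le_trans _ _ (m (D `|` C))%:E); last first.
  by apply: open_content_ub; rewrite hatU => p [/DV[]|/CVU[]].
have CD0 : m (C `&` D) = 0%R.
  apply: m_hat0; apply/seteqP; split=> // p pCD.
  have [_] := DV _ (hatS (@subIsetr _ _ _) pCD); apply.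
  exact: hatS (@subIsetl _ _ _) _ pCD.
rewrite lee_fin; apply: (@le_trans _ _ (m D + m (C `\` D))%R).
  by rewrite lerD2l -[X in (m X <= _)%R](setUIDK C D) -[leRHS]add0r -CD0 mU_le.
rewrite -mU; last by apply/eqP; exact: setDIK.
by apply: mS => s [|[]]; [left|right].
Qed.

Local Lemma borel_caratheodory (B : set (borelType T)) :
  measurable B -> outer_content.-caratheodory B.
Proof.
move=> mB; apply: mB; split=> [|U]; last exact: open_caratheodory.
exact: sigma_algebra_measurable (caratheodory_type outer_content).
Qed.

Definition radon_extension : set (borelType T) -> \bar R := outer_content.

Local Lemma radon_extension_sigma_additive :
  semi_sigma_additive radon_extension.
Proof.
move=> F mF tF mUF; apply: (@caratheodory_measure_sigma_additive R T) => //.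
- by move=> n; exact: borel_caratheodory.
- exact: borel_caratheodory.
Qed.

HB.instance Definition _ := isMeasure.Build _ (borelType T) R radon_extension
  outer_content0 outer_content_ge0 radon_extension_sigma_additive.

Local Lemma radon_extension_fin : fin_num_fun radon_extension.
Proof. by move=> A _; exact: outer_content_fin. Qed.

HB.instance Definition _ := Measure_isFinite.Build _ (borelType T) R
  radon_extension radon_extension_fin.

(** Outer regularity at the complement of [B] turns into inner regularity at [B], since the total
    mass is finite and closed sets are compact. *)
Local Lemma radon_radon_extension : radon radon_extension.
Proof.
move=> B mB; apply/eqP; rewrite eq_le; apply/andP; split; last first.
  by apply: ge_ereal_sup => _ [C [_ CB] <-]; exact: outer_contentS.
apply/lee_addgt0Pr => e e0.
have [U [oU BU Ue]] := outer_content_adherent (~` B) e0.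
have carB := borel_caratheodory mB; have carU := open_caratheodory oU.
rewrite -outer_contentE// in Ue.
have /subsetC := BU; rewrite setCK => UB.
have cU : compact (~` U).
  by apply: (subclosed_compact (open_closedC oU) T_compact); exact: subsetT.
apply: (@le_trans _ _ (outer_content (~` U) + e%:E)); last first.
  by rewrite leeD2r//; apply: ereal_sup_ubound; exists (~` U).
change (outer_content B <= outer_content (~` U) + e%:E).
have /eqP := carU setT; rewrite {1}(carB setT) !setTI => /eqP BUT.
suff -> : outer_content B =
    outer_content U + outer_content (~` U) - outer_content (~` B).
  by rewrite leeBlDr ?outer_content_fin// addeC -addeA leeD2l// addeC.
by rewrite -BUT addeK ?outer_content_fin.
Qed.

Lemma radon_extensionP :
  exists2 mu : {finite_measure set (borelType T) -> \bar R}, radon mu &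
    forall C U, open U -> hat C `<=` U -> (m C)%:E <= mu U.
Proof.
exists radon_extension; first exact: radon_radon_extension.
move=> C U oU CU; rewrite /= /radon_extension outer_contentE//.
exact: open_content_ub.
Qed.

End RadonExtension.

(** * The remainder of a family of subsets of a countable set *)

Lemma compact_set_type (T : topologicalType) (A : set T) :
  compact A -> compact [set: set_type A].
Proof.
move=> cA F PF _.
have FA : (set_val @ F) A.
  by apply: (@filterS _ F _ setT) => [x _|]; [exact: set_valP|exact: filterT].
have [p [Ap clp]] := cA _ _ FA.
exists (exist _ p (mem_set Ap)); split=> // G N FG [V [[W oW WV] /= Vp] VN].
have [_ [[x Gx <-] Wx]] : set_val @` G `&` W !=set0.
  apply: clp.
    by apply: (@filterS _ F _ G) => // x Gx; exists x.
  by apply: open_nbhs_nbhs; split=> //; move: Vp; rewrite -WV.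
by exists x; split=> //; apply: VN; rewrite -WV.
Qed.

Lemma hausdorff_set_type (T : topologicalType) (A : set T) :
  hausdorff_space T -> hausdorff_space (set_type A).
Proof.
move=> hT p q pq; apply/val_inj/hT => B C pB qC.
have [z [Bz Cz]] := pq _ _ (@initial_continuous _ _ set_val p _ pB)
  (@initial_continuous _ _ set_val q _ qC).
by exists (set_val z).
Qed.

(** * Cylinders in the cube of 0-1 functions *)

Section Cube.
Variable I : choiceType.
Local Notation cube := {ptws I -> bool}.

Lemma open_coordinate (j : I) (b : bool) : open [set q : cube | q j = b].
Proof.
have cj : continuous (fun q : cube => q j) := @proj_continuous I (fun=> bool) j.
by move/continuousP : cj => /(_ [set b]); apply; exact: discrete_open.
Qed.

(** The cylinders around [p] generate a filter; it converges to [p] because it does so in each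
    coordinate. *)
Lemma nbhs_cylinder (p : cube) (U : set cube) : nbhs p U ->
  exists F : seq I, [set q : cube | {in F, q =1 p}] `<=` U.
Proof.
pose cyl (F : seq I) := [set q : cube | {in F, q =1 p}].
have FF : Filter (filter_from setT cyl).
  apply: filter_from_filter; first by exists [::].
  move=> F G _ _; exists (F ++ G) => // q qFG.
  by split=> j jF; apply: qFG; rewrite mem_cat jF ?orbT.
suff cvp : filter_from setT cyl --> p by move=> /cvp[F _ FU]; exists F.
apply/cvg_sup => j A [B [[C oC <-] /= Cp] BA].
exists [:: j] => // q qp; apply: BA => /=.
by rewrite qp// mem_head.
Qed.

Lemma open_cylinder (p : cube) (F : seq I) :
  open [set q : cube | {in F, q =1 p}].
Proof.
elim: F => [|j F IH].
  by rewrite [X in open X](_ : _ = setT)//; [exact: openT|exact/seteqP].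
rewrite [X in open X](_ : _ =
    [set q : cube | q j = p j] `&` [set q : cube | {in F, q =1 p}]).
  by apply: openI => //; exact: open_coordinate.
apply/seteqP; split=> [q qjF|q [qj qF] k].
  split=> [|k kF]; apply: qjF; rewrite ?mem_head// inE.
  by rewrite kF orbT.
by rewrite inE => /orP[/eqP ->//|]; exact: qF.
Qed.

Lemma cube_compact : compact [set: cube].
Proof.
have := @tychonoff I (fun=> bool) (fun=> setT) (fun=> bool_compact).
by congr (compact _); exact/seteqP.
Qed.

Lemma closure_cylinderP (A : set cube) (p : cube) :
  closure A p <-> forall F : seq I, exists2 q, A q & {in F, q =1 p}.
Proof.
split=> [clA F|Ap U /nbhs_cylinder[F FU]].
  have [|q [Aq qp]] := clA [set q : cube | {in F, q =1 p}]; last by exists q.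
  by apply: open_nbhs_nbhs; split; [exact: open_cylinder|move=> j].
by have [q Aq qp] := Ap F; exists q; split=> //; exact: FU.
Qed.

End Cube.

(** * The compactification of [X] generated by a family of sets *)

Section GrowthOfFamily.
Variables (X I : choiceType) (S : I -> X -> bool) (sing : X -> I).
Hypothesis singE : forall a s, S (sing a) s = (s == a).

Local Notation cube := {ptws I -> bool}.

(** A point of the cube chooses [S j] or its complement for each [j]. Points in the closure of the
    codes are the ultrafilters of the algebra generated by the [S j]; codes are the principal
    ones. *)
Definition family_code (s : X) : cube := fun j => S j s.
Local Notation code := family_code.

Definition remainder : set cube := closure (range code) `\` range code.
Local Notation K := (set_type remainder).

Definition trace (C : set X) : set K := set_val @^-1` closure (code @` C).

Lemma closure_codeP (C : set X) (p : cube) :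
  closure (code @` C) p <->
  forall F : seq I, exists2 s, C s & {in F, forall j, S j s = p j}.
Proof.
rewrite closure_cylinderP; split=> clp F; have [] := clp F.
  by move=> _ [s Cs <-] sp; exists s.
by move=> s Cs sp; exists (code s) => //; exists s.
Qed.

(** Near a point whose coordinate [sing a] is true, [a] is the only available approximant. *)
Lemma closure_code_sing (C : set X) (p : cube) a :
  closure (code @` C) p -> p (sing a) -> C a /\ p = code a.
Proof.
move=> /closure_codeP clp pa.
have sE (F : seq I) : exists2 s, C s & s = a /\ {in F, forall j, S j s = p j}.
  have [s Cs sF] := clp (sing a :: F); exists s => //; split.
    by apply/eqP; rewrite -singE sF ?mem_head.
  by move=> j jF; apply: sF; rewrite inE jF orbT.
split; first by have [s Cs [<-]] := sE [::].
apply/funext => j; have [s _ [sa /(_ j)]] := sE [:: j].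
by rewrite mem_head -sa /family_code => ->.
Qed.

(** Within the closure, avoiding the codes thus becomes a closed condition on coordinates, which
    makes the remainder compact. *)
Lemma remainderP (p : cube) : remainder p <->
  closure (range code) p /\ forall a, p (sing a) = false.
Proof.
split=> [[clp pX]|[clp pX]]; split=> //.
  move=> a; apply/negP => /(closure_code_sing clp)[_ pa].
  by apply: pX; exists a.
by move=> [a _ ap]; move: (pX a); rewrite -ap /family_code singE eqxx.
Qed.

Lemma remainder_compact : compact [set: K].
Proof.
apply: compact_set_type; apply: subclosed_compact (@cube_compact I) _ => //.
rewrite [remainder](_ : _ = closure (range code) `&`
    \bigcap_a [set p : cube | p (sing a) = false]).
  apply: closedI; first exact: closed_closure.
  apply: closed_bigI => a _.
  rewrite [X in closed X](_ : _ = ~` [set p : cube | p (sing a) = true]).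
    exact/open_closedC/open_coordinate.
  by apply/seteqP; split=> p /=; case: (p _).
apply/seteqP; split=> p.
  by move=> /remainderP[clp pX]; split=> // a _ /=.
by move=> [clp pX]; apply/remainderP; split=> // a; exact: pX.
Qed.

(** Extend [G] to an ultrafilter on [X] and record which [S j] it contains; freeness keeps the
    result off the codes. *)
Lemma free_filter_trace (G : set_system X) : ProperFilter G ->
  (forall a, G [set~ a]) -> exists x : K, forall C, G C -> trace C x.
Proof.
move=> PG freeG; have [G' [uG' GG']] := ultraFilterLemma PG.
pose p : cube := fun j => `[< G' [set s | S j s] >].
have pP j : G' [set s | S j s = p j].
  rewrite /p; case: asboolP => [//|nG'].
  have [//|] := in_ultra_setVsetC [set s | S j s] uG'.
  by apply: filterS => s /= /negP/negbTE.
have clp C : G' C -> closure (code @` C) p.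
  move=> GC; apply/closure_codeP => F.
  have GF : G' [set s | {in F, forall j, S j s = p j}].
    elim: F => [|j F IH]; first by apply: filterS filterT => s _ j.
    apply: filterS (filterI (pP j) IH) => s [sj sF] k.
    by rewrite inE => /orP[/eqP ->//|]; exact: sF.
  by have [s [Cs sF]] := filter_ex (filterI GC GF); exists s.
have Kp : remainder p.
  apply/remainderP; split=> [|a]; first by apply: clp; exact: filterT.
  apply/negP => /asboolP Ga.
  have [s [/=]] := filter_ex (filterI Ga (GG' _ (freeG a))).
  by rewrite singE => /eqP.
by exists (exist _ p (mem_set Kp)) => C /GG' /clp.
Qed.

Lemma trace_finite C : finite_set C -> trace C = set0.
Proof.
move=> /finite_seqP[r Cr]; apply/seteqP; split=> // x clx.
have [s Cs sr] := (closure_codeP _ _).1 clx (map sing r).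
have /remainderP[_ /(_ s) xs] := set_valP x.
suff : S (sing s) s = false by rewrite singE eqxx.
by apply: eq_trans xs; apply: sr; apply: map_f; move: Cs; rewrite Cr.
Qed.

Lemma trace_infinite C : infinite_set C -> trace C !=set0.
Proof.
(* The filter of sets that contain all but finitely many points of [C]. *)
move=> infC; pose G := [set A : set X | finite_set (C `\` A)].
have PG : ProperFilter G.
  split; first by rewrite /G /= setD0.
  split; first by rewrite /G /= setDT.
    by move=> A B GA GB; rewrite /G /= setDIr finite_setU.
  by move=> A B AB; apply: sub_finite_set; exact: setDS.
have [|x xG] := free_filter_trace PG.
  by move=> a; apply: (@sub_finite_set _ _ [set a]) => // s [_] /= /contrapT.
by exists x; apply: xG; rewrite /G /= setDv.
Qed.

Lemma trace_closed C : closed (trace C).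
Proof.
rewrite -openC; exists (~` closure (code @` C)) => //.
exact/closed_openC/closed_closure.
Qed.

Lemma traceU : {morph trace : C D / C `|` D}.
Proof. by move=> C D; rewrite /trace image_setU closureU preimage_setU. Qed.

Lemma traceT : trace setT = setT.
Proof.
by apply/seteqP; split=> // x _; have /remainderP[] := set_valP x.
Qed.

(** The witness is kept in the explicit form of a pattern because positivity of [m] will be known
    for patterns. *)
Lemma trace_base (U : set K) (x : K) : open U -> U x ->
  exists F : seq I, let W := [set s | {in F, forall j, S j s = set_val x j}] in
    ~ trace (~` W) x /\ trace W `<=` U.
Proof.
move=> [V oV <-] Vx.
have [F FV] := nbhs_cylinder (open_nbhs_nbhs (conj oV Vx)).
exists F => W; split.
  by move=> /closure_codeP/(_ F)[s].
move=> y /closure_codeP clyW; apply: FV => j jF.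
have [s sW sy] := clyW [:: j].
by rewrite -sy ?mem_head// sW.
Qed.

(** If the pattern were finite, [x] would be a limit of points outside it, although these disagree
    with [x] somewhere on [F]. *)
Lemma trace_pattern (x : K) (F : seq I) :
  infinite_set [set s | {in F, forall j, S j s = set_val x j}].
Proof.
set W := [set s | _] => /trace_finite W0.
have : trace (W `|` ~` W) x by rewrite setUv traceT.
rewrite traceU W0 set0U => /closure_codeP/(_ F)[s]; exact.
Qed.


Lemma remainder_growth (e : nat -> X) : bijective e -> growth_of_omega K.
Proof.
move=> [e' eK e'K].
pose A := closure (range code).
have Acode s : A (code s) by apply: subset_closure; exists s.
pose i n : set_type A := exist _ (code (e n)) (mem_set (Acode (e n))).
have AK (x : K) : A (set_val x) by have [] := set_valP x.
pose incl (x : K) : set_type A := exist _ (set_val x) (mem_set (AK x)).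
have code_inj : injective code.
  move=> s t /(congr1 (fun p : cube => p (sing s))).
  by rewrite /family_code !singE eqxx => /esym/eqP.
exists (set_type A), i, incl; split.
- split.
  + apply: compact_set_type.
    apply: subclosed_compact (@cube_compact I) _ => //.
    exact: closed_closure.
  + apply: hausdorff_set_type; apply: hausdorff_product => _.
    exact: discrete_hausdorff.
  + split.
      by move=> n k /(congr1 set_val)/code_inj/(can_inj eK).
    move=> U; split=> _; last exact: discrete_open.
    (* Among the codes, only that of [e n] has coordinate [sing (e n)] true. *)
    exists (\bigcup_(n in U) [set z : set_type A | set_val z (sing (e n))]).
      apply: bigcup_open => n _.
      exists [set z : cube | z (sing (e n)) = true] => //.
      exact: open_coordinate.
    apply/seteqP; split=> [n [k Uk]|n Un].
      change (S (sing (e k)) (e n) -> U n).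
      by rewrite singE => /eqP/(can_inj eK) ->.
    exists n => //; change (is_true (S (sing (e n)) (e n))).
    by rewrite singE.
  + move=> O [z Oz] [V oV VO].
    have [p [[s _ <-] Vp]] : range code `&` V !=set0.
      apply: (set_valP z); apply: open_nbhs_nbhs; split=> //.
      by move: Oz; rewrite -VO.
    exists (i (e' s)); split; last by exists (e' s).
    by rewrite -VO; change (V (code (e (e' s)))); rewrite e'K.
- split.
    by move=> x y xy; apply: val_inj; exact: (congr1 set_val xy).
  move=> U; split.
    by move=> [V oV <-]; exists (set_val @^-1` V) => //; exists V.
  by move=> [_ [V oV <-] <-]; exists V.
- apply/seteqP; split.
    move=> _ [x _ <-] [n _ /(congr1 set_val)/= xn].
    by have [_] := set_valP x; apply; exists (e n).
  move=> z zi; have Kz : remainder (set_val z).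
    split; first exact: set_valP.
    move=> [s _ sz]; apply: zi; exists (e' s) => //.
    by apply: val_inj; change (code (e (e' s)) = set_val z); rewrite e'K.
  by exists (exist _ (set_val z) (mem_set Kz)) => //; exact: val_inj.
Qed.

End GrowthOfFamily.

(** * Bit matrices and the densities of their levels *)

Section Prescription.
Variable E : finType.
Implicit Types (D : {set E}) (v : E -> bool).

Definition prescribed D v :=
  [set s : {ffun E -> bool} | [forall x in D, s x == v x]]%SET.

(** Each prescribed cell halves the count; the product form avoids division. *)
Lemma card_prescribed D v : (#|prescribed D v| * 2 ^ #|D|)%N = (2 ^ #|E|)%N.
Proof.
pose F x : pred bool := if x \in D then pred1 (v x) else predT.
have -> : #|prescribed D v| = #|(family F : simpl_pred {ffun E -> bool})|.
  apply: eq_card => s; rewrite inE; apply/forallP/familyP => sv x.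
    by rewrite /F; case: ifPn => // xD; move: (sv x); rewrite xD.
  by apply/implyP => xD; move: (sv x); rewrite /F xD.
rewrite card_family foldrE big_map big_enum/= (bigID (mem D))/=.
rewrite big1 => [|x xD]; last by rewrite /F xD card1.
rewrite (eq_bigr (fun=> 2%N)) => [|x xD]; last first.
  by rewrite /F (negbTE xD) card_bool.
by rewrite prod_nat_const mul1n -expnD addnC cardC.
Qed.

End Prescription.

(* The entries of an [n x n] matrix and one cell per 0-1 string of length [n]. *)
Definition cell (n : nat) : finType := ('I_n * 'I_n + {ffun 'I_n -> bool})%type.

Definition node : countType := {n : nat & {ffun cell n -> bool}}.

Definition mk_node n (s : {ffun cell n -> bool}) : node := existT _ n s.

Definition level (s : node) : nat := tag s.

(* Junk value [false] outside of the matrix. *)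
Definition entry (s : node) (i j : nat) : bool :=
  if (insub i, insub j) is (Some a, Some b) then tagged s (inl (a, b))
  else false.

Definition flag (c : nat -> bool) (s : node) : bool :=
  tagged s (inr [ffun k : 'I_(tag s) => c k]).

(* Only the first [i + 1] entries of row [i] count, so that a random row agrees
   with [f] with probability [2^-(i+1)]. *)
Definition avoids (f : nat -> nat -> bool) (s : node) : bool :=
  all (fun i => has (fun j => entry s i j != f i j) (iota 0 i.+1))
    (iota 0 (level s)).

Lemma entryE n (s : {ffun cell n -> bool}) (i j : 'I_n) :
  entry (mk_node s) i j = s (inl (i, j)).
Proof. by rewrite /entry !valK. Qed.

Lemma avoidsP f s : reflect
  (forall i, (i < level s)%N -> exists2 j, (j <= i)%N & entry s i j != f i j)
  (avoids f s).
Proof.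
apply: (iffP allP) => fs i => [si|].
  have /fs/hasP[j] : i \in iota 0 (level s) by rewrite mem_iota.
  by rewrite mem_iota => ji ne; exists j.
rewrite mem_iota => /fs[j ji ne]; apply/hasP; exists j => //.
by rewrite mem_iota.
Qed.

(** * Counting the points of a level that dodge finitely many [f] *)

Section LevelCount.
Variables (n N : nat) (fs : seq (nat -> nat -> bool)).
Variables (D : {set cell n}) (v : cell n -> bool).
Hypothesis Nn : (N <= n)%N.
Hypothesis D_low : forall i j : 'I_n, inl (i, j) \in D -> (i < N)%N.
Hypothesis fs_small : (2 * size fs <= 2 ^ N)%N.

Definition row_cells (i : 'I_n) : {set cell n} :=
  [set x : cell n |
    if x is inl (k, j) then (k == i) && (j <= i)%N else false]%SET.

Lemma card_row i : #|row_cells i| = i.+1.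
Proof.
have wP (j : 'I_i.+1) : (j < n)%N by exact: leq_trans (ltn_ord j) (ltn_ord i).
pose w j : cell n := inl (i, Ordinal (wP j)).
have winj : injective w by move=> j k [] /val_inj.
rewrite -[RHS]card_ord -(card_imset _ winj); apply: eq_card => x.
rewrite inE; apply/idP/imsetP => [|[j _ ->]].
  case: x => [[k j]|//] /andP[/eqP -> ji].
  exists (Ordinal (ji : (j < i.+1)%N)) => //.
  by rewrite /w; congr (inl (_, _)); exact: val_inj.
by rewrite /= eqxx -ltnS ltn_ord.
Qed.

Definition hitting (f : nat -> nat -> bool) (i : 'I_n) :=
  prescribed (D :|: row_cells i)%SET
    (fun x => if x \in D then v x
              else if x is inl (k, j) then f k j else false).

(** Row [i] is disjoint from [D] by [D_low], so agreement with [f] on it costs [i + 1] further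
    bits. *)
Lemma card_hitting f (i : 'I_n) : (N <= i)%N ->
  (#|hitting f i| * 2 ^ i.+1)%N = #|prescribed D v|.
Proof.
move=> Ni; apply/eqP; rewrite -(eqn_pmul2r (expn_gt0 2 #|D|)) card_prescribed.
have <- := card_prescribed (D :|: row_cells i)%SET
  (fun x => if x \in D then v x else if x is inl (k, j) then f k j else false).
rewrite -mulnA -expnD cardsU card_row.
suff -> : (D :&: row_cells i = finset.set0)%SET by rewrite cards0 subn0 addnC.
apply/setP => x; rewrite !inE; apply/negP => /andP[xD].
case: x xD => [[k j]|//] /D_low kN /andP[/eqP ki _].
by move: kN; rewrite ki ltnNge Ni.
Qed.

(** Only rows from [N] on are tested: in the application, the relevant entries of the earlier rows
    are prescribed by [D]. *)
Definition dodging := [set s in prescribed D v |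
  all (fun f : nat -> nat -> bool =>
  [forall i : 'I_n, (N <= i)%N ==>
    [exists j : 'I_n, (j <= i)%N && (s (inl (i, j)) != f i j)]]) fs]%SET.

(** Union bound over the rows on which some [f] is hit. *)
Lemma prescribed_cover : (#|prescribed D v| <=
  #|dodging| + \sum_(f <- fs) \sum_(i < n | N <= i) #|hitting f i|)%N.
Proof.
pose H := (\bigcup_(f <- fs) \bigcup_(i < n | (N <= i)%N) hitting f i)%SET.
have Hle : (#|H| <= \sum_(f <- fs) \sum_(i < n | N <= i) #|hitting f i|)%N.
  rewrite /H; elim/big_ind2 : _ => [|A a B b Aa Bb|f _].
  - by rewrite cards0.
  - by rewrite (leq_trans (leq_card_setU _ _))// leq_add.
  elim/big_ind2 : _ => [|A a B b Aa Bb|i _ //]; first by rewrite cards0.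
  by rewrite (leq_trans (leq_card_setU _ _))// leq_add.
apply: leq_trans (leq_add (leqnn _) Hle).
apply: leq_trans (leq_card_setU _ _).
apply/subset_leq_card/fintype.subsetP => s sD.
rewrite finset.in_setU [s \in dodging]finset.inE sD/=.
case: allP => //= /existsNP[f] /not_implyP[ffs /negP].
rewrite negb_forall => /existsP[i]; rewrite negb_imply => /andP[Ni].
rewrite negb_exists => /forallP sf.
rewrite /H (big_rem f)//= inE; apply/orP; left.
apply/bigcupP; exists i => //; rewrite inE; apply/forallP => x.
apply/implyP; rewrite inE.
case: ifPn => [xD _|xD /=].
  by move: sD; rewrite inE => /forallP/(_ x); rewrite xD.
rewrite inE; case: x xD => [[k j]|//] _ /andP[/eqP -> ji].
by have := sf j; rewrite ji negbK.
Qed.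

(** The hits take up at most the fraction [size fs / 2 ^ N] of the prescribed points, which is at
    most one half by [fs_small]. *)
Lemma card_dodging : (#|prescribed D v| <= 2 * #|dodging|)%N.
Proof.
rewrite -(ler_nat rat) natrM.
set a : rat := #|prescribed D v|%:R.
have hE f (i : 'I_n) : (N <= i)%N -> #|hitting f i|%:R = a / 2 ^+ i.+1.
  by move=> Ni; rewrite /a -(card_hitting f Ni) natrM natrX mulfK.
have geo : \sum_(i < n | (N <= i)%N) (a / 2 ^+ i.+1) <= a / 2 ^+ N.
  rewrite -(big_geq_mkord N n xpredT (fun i => a / 2 ^+ i.+1)).
  (* The geometric sum telescopes, as [a / 2 ^+ i.+1] equals [F i.+1 - F i]. *)
  pose F i : rat := - (a / 2 ^+ i).
  apply: (@le_trans _ _ (\sum_(N <= i < n) (F i.+1 - F i))).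
    rewrite le_eqVlt; apply/orP; left; apply/eqP/eq_bigr => i _.
    by rewrite /F exprS invfM; field.
  by rewrite telescope_sumr// /F opprK addrC gerBl divr_ge0 ?exprn_ge0.
have : a <= #|dodging|%:R +
    \sum_(f <- fs) \sum_(i < n | (N <= i)%N) (a / 2 ^+ i.+1).
  rewrite /a; have := prescribed_cover; rewrite -(ler_nat rat) natrD.
  rewrite natr_sum; under eq_bigr => f _ do rewrite natr_sum.
  by under eq_bigr => f _ do under eq_bigr => i Ni do rewrite (hE f i Ni).
have : \sum_(f <- fs) \sum_(i < n | (N <= i)%N) (a / 2 ^+ i.+1) <= a / 2.
  apply: (@le_trans _ _ (\sum_(f <- fs) (a / 2 ^+ N))).
    by apply: ler_sum => f _; exact: geo.
  rewrite big_const_seq count_predT iter_addr addr0 -mulrnAr.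
  apply: ler_wpM2l; first by rewrite /a ler0n.
  rewrite -mulr_natl ler_pdivrMr ?exprn_gt0// mulrC ler_pdivlMr// mulrC.
  by rewrite -natrX -natrM ler_nat.
lra.
Qed.

End LevelCount.

(** * Densities on the levels and their limit *)

Section Density.
Variable R : realFieldType.

Definition density (n : nat) (C : set node) : R :=
  #|[set s : {ffun cell n -> bool} | `[< C (mk_node s) >]]%SET|%:R /
  2 ^+ #|cell n|.

Lemma density_ge0 n C : 0 <= density n C.
Proof. by rewrite divr_ge0 ?exprn_ge0. Qed.

Lemma density_le1 n C : density n C <= 1.
Proof.
rewrite ler_pdivrMr ?exprn_gt0// mul1r -natrX ler_nat.
by apply: leq_trans (max_card _) _; rewrite card_ffun card_bool.
Qed.

Lemma densityU n C D : [disjoint C & D] ->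
  density n (C `|` D) = density n C + density n D.
Proof.
move=> /eqP CD; rewrite /density -mulrDl -natrD; congr (_%:R / _).
rewrite -cardsUI [X in (_ + X)%N](_ : _ = 0%N) ?addn0; last first.
  apply/eqP; rewrite cards_eq0; apply/eqP/setP => s; rewrite !inE.
  apply/negP => /andP[/asboolP Cs /asboolP Ds].
  by have : (C `&` D) (mk_node s) by []; rewrite CD.
by apply: eq_card => s; rewrite !inE asbool_or.
Qed.

Lemma density_finite C : finite_set C -> \forall n \near \oo, density n C = 0.
Proof.
move=> /finite_seqP[r Cr]; exists (\max_(s <- r) level s).+1 => // n /= rn.
rewrite /density [X in X%:R](_ : _ = 0%N) ?mul0r//.
apply/eqP; rewrite cards_eq0; apply/eqP/setP => s; rewrite !inE.
apply/asboolP; rewrite Cr /= => sr.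
have := leq_bigmax_seq (P := xpredT) (F := level) (mk_node s) sr isT.
by rewrite leqNgt rn.
Qed.

Lemma finite_below n : finite_set [set s : node | (level s < n)%N].
Proof.
rewrite [X in finite_set X](_ : _ =
  \bigcup_(k in `I_n) [set mk_node s | s in [set: {ffun cell k -> bool}]]).
  apply: bigcup_finite => // k _; apply: finite_image; exact: finite_finset.
apply/seteqP; split=> [[k s] kn|_ [k kn [s _ <-]]] //.
by exists k => //; exists s.
Qed.

Lemma infinite_above (C : set node) n : infinite_set C ->
  exists2 s, C s & (n <= level s)%N.
Proof.
move=> infC; apply: contrapT => Cn; apply: infC.
apply: sub_finite_set (finite_below n) => s Cs /=; rewrite ltnNge.
by apply/negP => ns; apply: Cn; exists s.
Qed.

(** This makes the flags of the members of [cs] distinct cells on every level from [N] on. *)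
Definition separated (N : nat) (cs : seq (nat -> bool)) := forall c c',
  c \in cs -> c' \in cs -> (forall i, (i < N)%N -> c i = c' i) -> c = c'.

Lemma near_in_seq (T : eqType) (r : seq T) (P : T -> nat -> Prop) :
  (forall x, \forall N \near \oo, P x N) ->
  \forall N \near \oo, forall x, x \in r -> P x N.
Proof.
move=> PN; elim: r => [|y r IH]; first by near=> N => x.
near=> N => x; rewrite inE => /orP[/eqP ->|]; first by near: N.
by move: x; near: N.
Unshelve. all: by end_near. Qed.

Lemma near_separated cs : \forall N \near \oo, separated N cs.
Proof.
have sep c c' : \forall N \near \oo, (forall i, (i < N)%N -> c i = c' i) ->
    c = c' :> (nat -> bool).
  have [->|/eqP cc'] := eqVneq c c'; first exact: nearW.
  have [i ci] : exists i, c i <> c' i.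
    by apply/existsNP => cc; apply: cc'; exact/funext.
  by near=> N => cN; case: ci; apply: cN; near: N; exact: nbhs_infty_gt.
have := near_in_seq cs (fun c => near_in_seq cs (sep c)).
by apply: filterS => N cN c c' cc cc'; exact: cN.
Unshelve. all: by end_near. Qed.

(** Copying the matrix of [t] and fixing the flags in [cs] prescribes at most
    [level t * level t + size cs] cells; at least half of the remaining choices dodge [fs], which
    explains the [.+1]. The bound does not depend on [n]. *)
Lemma density_pattern (t : node) (n : nat) fs cs (q : (nat -> bool) -> bool)
    (C : set node) :
    (level t <= n)%N -> (2 * size fs <= 2 ^ level t)%N ->
    separated (level t) cs ->
    (forall s, level s = n ->
      (forall i j, (i < level t)%N -> (j < level t)%N ->
        entry s i j = entry t i j) ->
      (forall c, c \in cs -> flag c s = q c) ->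
      (forall f i, f \in fs -> (level t <= i < n)%N ->
        exists2 j, (j <= i)%N & entry s i j != f i j) ->
      C s) ->
  (2 ^+ (level t * level t + size cs).+1)^-1 <= density n C.
Proof.
set N := level t => Nn fsN csN patC.
pose tr (c : nat -> bool) : {ffun 'I_n -> bool} := [ffun k : 'I_n => c k].
pose wd := widen_ord Nn.
pose D : {set cell n} :=
  ([set inl (wd ij.1, wd ij.2) | ij : 'I_N * 'I_N] :|:
   [set x in [seq inr (tr c) | c <- cs]])%SET.
(* At a flag cell, [q] is read off at a member of [cs] with that initial segment; [csN] makes this
   member unique. *)
pose v (x : cell n) := match x with
  | inl (i, j) => entry t i j
  | inr a => has (fun c => (tr c == a) && q c) cs end.
have cardD : (#|D| <= N * N + size cs)%N.
  apply: leq_trans (leq_card_setU _ _) _; apply: leq_add.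
    by apply: leq_trans (leq_imset_card _ _) _; rewrite card_prod card_ord.
  by rewrite cardsE; apply: leq_trans (card_size _) _; rewrite size_map.
have Dlow (i j : 'I_n) : inl (i, j) \in D -> (i < N)%N.
  rewrite !inE => /orP[/imsetP[[k l] _ [-> _]]|/mapP[]//]; exact: (ltn_ord k).
have DN (i j : 'I_n) : (i < N)%N -> (j < N)%N -> inl (i, j) \in D.
  move=> iN jN; rewrite inE; apply/orP; left; apply/imsetP.
  exists (Ordinal iN, Ordinal jN) => //; congr (inl (_, _)); exact: val_inj.
have Dc c : c \in cs -> inr (tr c) \in D.
  by move=> cc; rewrite !inE; apply/orP; right; exact: map_f.
have dodgeC : (#|dodging N fs D v| <=
    #|[set s : {ffun cell n -> bool} | `[< C (mk_node s) >]]%SET|)%N.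
  apply/subset_leq_card/fintype.subsetP => s; rewrite !inE.
  move=> /andP[/forallP sD /allP sfs]; apply: patC => //.
  - move=> i j iN jN.
    have [in_ jn] := (leq_trans iN Nn, leq_trans jN Nn).
    rewrite -[i]/(val (Ordinal in_)) -[j]/(val (Ordinal jn)) entryE.
    by have := sD (inl (Ordinal in_, Ordinal jn)); rewrite DN// => /eqP.
  - move=> c cc; have := sD (inr (tr c)); rewrite Dc//= => /eqP sv.
    rewrite /flag /= [LHS]sv.
    apply/hasP/idP => [[c' cc' /andP[/eqP cE qc']]|qc].
      rewrite -(csN c' c)// => i iN.
      have := congr1
        (fun g : {ffun 'I_n -> bool} => g (Ordinal (leq_trans iN Nn))) cE.
      by rewrite !ffunE.
    by exists c; rewrite ?eqxx.
  - move=> f i ff /andP[Ni in_].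
    have /forallP/(_ (Ordinal in_)) := sfs _ ff.
    rewrite Ni => /existsP[j /andP[ji sj]].
    by exists j => //; rewrite -[i]/(val (Ordinal in_)) entryE.
rewrite ler_pdivlMr ?exprn_gt0// mulrC ler_pdivrMr ?exprn_gt0//.
rewrite -natrX -natrX -natrM ler_nat.
have := card_prescribed D v; have := card_dodging v Nn Dlow fsN.
move=> h1 <-; apply: (@leq_trans (2 * #|dodging N fs D v| * 2 ^ #|D|)).
  by rewrite leq_mul2r h1 orbT.
rewrite [(2 * _)%N]mulnC -mulnA -expnS leq_mul//.
by rewrite leq_pexp2l.
Qed.

End Density.

Definition coordinate : choiceType :=
  (node + ((nat -> nat -> bool) + (nat -> bool)))%type.

Definition member (j : coordinate) (s : node) : bool :=
  match j with
  | inl a => s == a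
  | inr (inl f) => avoids f s
  | inr (inr c) => flag c s
  end.

(** A single node [t] of [W] of large level suffices: on every later level, a fixed fraction of all
    nodes shares its pattern on [F]. *)
Lemma pattern_density (R : realFieldType) (F : seq coordinate)
    (p : coordinate -> bool) :
    let W := [set s | {in F, forall j, member j s = p j}] in infinite_set W ->
  exists2 e : R, 0 < e & \forall n \near \oo, e <= density R n W.
Proof.
move=> W infW.
pose nodes :=
  pmap (fun j : coordinate => if j is inl a then Some a else None) F.
pose fs := pmap
  (fun j : coordinate => if j is inr (inl f) then Some f else None) F.
pose cs := pmap
  (fun j : coordinate => if j is inr (inr c) then Some c else None) F.
have nodesF a : inl a \in F -> a \in nodes.
  by move=> aF; rewrite mem_pmap; apply/mapP; exists (inl a).
have fsF f : inr (inl f) \in F -> f \in fs.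
  by move=> fF; rewrite mem_pmap; apply/mapP; exists (inr (inl f)).
have csF c : c \in cs <-> inr (inr c) \in F.
  rewrite mem_pmap; split=> [/mapP[[a|[f|c']] // c'F [->]] //|cF].
  by apply/mapP; exists (inr (inr c)).
have [N0 _ sepN] := near_separated cs.
(* The level of [t] must separate [cs], bound [2 * size fs], and exceed the levels of all nodes
   named in [F]. *)
have [t Wt tN] := infinite_above (maxn N0
  (maxn (2 * size fs) (\max_(a <- nodes) level a).+1)) infW.
move: tN; rewrite !geq_max => /and3P[N0t fst nodest].
exists (2 ^+ (level t * level t + size cs).+1)^-1.
  by rewrite invr_gt0 exprn_gt0.
near=> n.
have tn : (level t <= n)%N by near: n; exact: nbhs_infty_ge.
apply: (@density_pattern R t n fs cs (fun c => p (inr (inr c)))) => //.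
- exact: leq_trans fst (ltnW (ltn_expl _ _)).
- exact: sepN.
move=> s sn st sflag savoid [a|[f|c]] jF.
- have atn : (level a < level t)%N.
    apply: leq_ltn_trans nodest.
    exact: (leq_bigmax_seq (P := xpredT) (F := level) a (nodesF _ jF)).
  have sa : s != a by apply/eqP => sa; move: atn; rewrite -sa sn ltnNge tn.
  have <- := Wt _ jF; rewrite /= (negbTE sa).
  by apply/esym/eqP => ta; move: atn; rewrite ta ltnn.
(* For [i] below [level t], the test of row [i] reads only its first [i + 1] entries, all inside the
   copied matrix. Hence a failure of [t] persists in [s]; later rows pass by [savoid]. *)
- have lts : (level t <= level s)%N by rewrite sn.
  have <- := Wt _ jF; rewrite /=; apply/avoidsP/avoidsP => fP i it.
    have [j ji] := fP i (leq_trans it lts).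
    by rewrite st//; [exists j|exact: leq_ltn_trans ji it].
  have [it'|it'] := ltnP i (level t).
    have [j ji ne] := fP i it'; exists j => //.
    by rewrite st//; exact: leq_ltn_trans ji it'.
  by apply: savoid; [exact: fsF|rewrite it' -sn].
- by rewrite /= sflag//; apply/csF.
Unshelve. all: by end_near. Qed.

Lemma cvg_ultra_bounded (R : realType) (T : Type) (U : set_system T)
    (f : T -> R) (a b : R) : UltraFilter U ->
  (forall x, a <= f x <= b) -> exists l : R, f @ U --> l.
Proof.
move=> uU fab; have ufU : UltraFilter (f @ U).
  split; first exact: fmap_proper_filter.
  move=> G PG fUG; apply/seteqP; split=> // A GA.
  have [//|nA] := in_ultra_setVsetC (f @^-1` A) uU.
  by have [y [Ay /(_ Ay)]] := filter_ex (filterI GA (fUG (~` A) nA)).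
have := @segment_compact R a b; rewrite compact_ultra => /(_ (f @ U) ufU).
case=> [|l [_ fl]]; last by exists l.
apply: (@filterS _ U _ setT) => [x _|]; last exact: filterT.
by rewrite /= in_itv/= fab.
Qed.

(** Limits along one ultrafilter refining the eventual filter exist for all [C] at once and preserve
    sums and eventual lower bounds. *)
Lemma limit_density (R : realType) : exists m : set node -> R,
  [/\ forall C, 0 <= m C,
      forall C D, [disjoint C & D] -> m (C `|` D) = m C + m D,
      forall C, finite_set C -> m C = 0 &
      forall C e, (\forall n \near \oo, e <= density R n C) -> e <= m C].
Proof.
have [U [uU ooU]] := ultraFilterLemma (@eventually_filter).
have /choice[m mP] C : exists l : R, density R ^~ C @ U --> l.
  apply: (@cvg_ultra_bounded R _ _ _ 0 1) => n.
  by rewrite density_ge0 density_le1.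
exists m; split=> [C|C D CD|C finC|C e Ce].
- by apply: (cvgr_to_ge (mP C)); apply: nearW => n; exact: density_ge0.
- rewrite -(cvg_lim (@Rhausdorff R) (mP (C `|` D))).
  apply: cvg_lim; first exact: Rhausdorff.
  apply: cvg_trans (cvgD (mP C) (mP D)); apply: near_eq_cvg.
  by apply: nearW => n; rewrite densityU.
- rewrite -(cvg_lim (@Rhausdorff R) (mP C)).
  apply: cvg_lim; first exact: Rhausdorff.
  by apply: cvg_near_cst; apply: ooU; exact: density_finite.
- by apply: (cvgr_to_ge (mP C)); exact: ooU.
Qed.

Definition avoiding_node (f : nat -> nat -> bool) (n : nat) : node :=
  mk_node [ffun x : cell n => if x is inl (i, j) then ~~ f i j else false].

Lemma avoiding_nodeP f n : avoids f (avoiding_node f n).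
Proof.
apply/avoidsP => i /= in_; exists i => //.
rewrite -[i]/(val (Ordinal (in_ : (i < n)%N))) entryE ffunE.
by case: (f _ _).
Qed.

Definition flagged_node (cs : seq (nat -> bool)) (y : (nat -> bool) -> bool)
    (n : nat) : node :=
  mk_node [ffun x : cell n => if x is inr a then
    has (fun c : nat -> bool => ([ffun k : 'I_n => c k] == a) && y c) cs
    else false].

Lemma flagged_nodeP cs y n : separated n cs ->
  {in cs, forall c, flag c (flagged_node cs y n) = y c}.
Proof.
move=> sep c cc; rewrite /flag /= ffunE.
apply/hasP/idP => [[c' cc' /andP[/eqP cE yc']]|yc].
  rewrite -(sep c' c)// => i in_.
  have := congr1 (fun g : {ffun 'I_n -> bool} => g (Ordinal in_)) cE.
  by rewrite !ffunE.
by exists c; rewrite ?eqxx.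
Qed.

(** * The growth *)

Section PointedRemainder.
Variables (X I : choiceType) (S : I -> X -> bool) (sing : X -> I).
Hypothesis singE : forall a s, S (sing a) s = (s == a).

(** The base point is a parameter of the type, so that the pointed structure can be inferred from
    it. *)
Definition pointed_remainder (x0 : set_type (remainder S)) : Type :=
  set_type (remainder S).

HB.instance Definition _ x0 :=
  Topological.copy (pointed_remainder x0) (set_type (remainder S)).
HB.instance Definition _ x0 := isPointed.Build (pointed_remainder x0) x0.

(** Every nonempty open set contains the trace of a pattern of one of its points, and such patterns
    are infinite. *)
Lemma remainder_supports_measure (R : realType) (m : set X -> R)
    (x0 : set_type (remainder S)) :
    (forall C, 0 <= m C) ->
    (forall C D, [disjoint C & D] -> m (C `|` D) = m C + m D) ->
    (forall C, finite_set C -> m C = 0) ->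
    (forall (F : seq I) (p : I -> bool),
      let W := [set s | {in F, forall j, S j s = p j}] in
      infinite_set W -> 0 < m W) ->
  supports_measure R (pointed_remainder x0).
Proof.
move=> m_ge0 mU m_fin m_pos.
have t_base (U : set (pointed_remainder x0)) x : open U -> U x ->
    exists2 W, ~ trace (~` W) x & trace W `<=` U.
  move=> oU Ux; have [F [nWx WU]] := trace_base oU Ux.
  by exists [set s | {in F, forall j, S j s = set_val x j}].
have m_trace0 C : @trace _ _ S C = set0 -> m C = 0.
  move=> C0; apply: m_fin; apply: contrapT => /(trace_infinite singE).
  by rewrite C0 => -[].
have [mu rmu muP] := @radon_extensionP R (pointed_remainder x0) X m
  (@trace X I S) (remainder_compact singE) (@trace_closed _ _ S)
  (trace_finite singE (finite_set0 X)) (@traceU _ _ S) t_base m_ge0 mU m_trace0.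
exists mu => // U oU [x Ux].
have [F [_ WU]] := trace_base oU Ux.
apply: lt_le_trans (muP _ _ oU WU).
by rewrite lte_fin; apply: m_pos; exact: trace_pattern.
Qed.

End PointedRemainder.


Lemma continuous_ptws (T V : topologicalType) (I : Type)
    (f : T -> {ptws I -> V}) :
  (forall i, continuous (fun x => f x i)) -> continuous f.
Proof.
move=> fc x; apply/cvg_sup => i A [B [[C oC <-] Cfx] BA].
have xC : nbhs x ((fun y => f y i) @^-1` C).
  by apply: fc; exact: open_nbhs_nbhs.
suff : nbhs x (f @^-1` A) by [].
by apply: filterS xC => y /BA.
Qed.

Local Notation K := (set_type (remainder member)).

Lemma memberE a s : member (inl a) s = (s == a).
Proof. by []. Qed.

(* Otherwise every pattern [r] on row [k] is the [k]-th row of some [f_r] with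
   [x (f_r) = true]; but no node of level above [k] avoids all the [f_r]. *)
Lemma row_excluded (x : K) (k : nat) : exists r : nat -> bool,
  forall f : nat -> nat -> bool, (forall j, (j <= k)%N -> f k j = r j) ->
    set_val x (inr (inl f)) = false.
Proof.
apply: contrapT => /forallNP noexcl.
have /choice[f fP] (r : {ffun 'I_k.+1 -> bool}) :
    exists f : nat -> nat -> bool,
      (forall j : 'I_k.+1, f k j = r j) /\ set_val x (inr (inl f)) = true.
  pose r' j := oapp r false (insub j).
  have /existsNP[f /not_implyP[fr /eqP xf]] := noexcl r'.
  exists f; split=> [j|]; last by move: xf; case: (set_val x _).
  by rewrite fr ?/r' ?valK// -ltnS.
have := @trace_pattern _ _ _ _ memberE x
  [seq inr (inl (f r)) | r <- enum {ffun 'I_k.+1 -> bool}].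
move=> /(infinite_above k.+1)[s sP ks].
(* The actual row [k] of [s] is one of the patterns, so [s] would avoid an [f r] that agrees with
   this row. *)
pose r := [ffun j : 'I_k.+1 => entry s k j].
have [fr xf] := fP r.
have : avoids (f r) s.
  rewrite -[avoids _ _]/(member (inr (inl (f r))) s).
  by rewrite sP ?xf// map_f ?mem_enum.
move=> /avoidsP/(_ k ks)[j jk].
by rewrite -[j]/(val (Ordinal (jk : (j < k.+1)%N))) fr ffunE eqxx.
Qed.

Lemma remainder_not_separable (x0 : K) : ~ separable (pointed_remainder x0).
Proof.
move=> [D cD dD].
have [d Dd] : exists d : nat -> pointed_remainder x0, D `<=` range d.
  have /pfcard_geP[->|[d]] := cD; first by exists (fun=> x0).
  by exists d => y Dy; have [k _ <-] := 'surj_d Dy; exists k.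
(* Diagonalization: row [k] of [r] is the pattern excluded by [d k]. *)
have /choice[r rP] k := row_excluded (d k) k.
have oU : open [set x : pointed_remainder x0 | set_val x (inr (inl r)) = true].
  exists [set q : {ptws coordinate -> bool} | q (inr (inl r)) = true] => //.
  exact: open_coordinate.
have [x [/= xr Dx]] :
    [set x : pointed_remainder x0 | set_val x (inr (inl r)) = true] `&` D
    !=set0.
  apply: dD => //.
  (* Every level contains a node avoiding [r], so the open set is nonempty. *)
  have inf : infinite_set [set s | avoids r s].
    move=> /finite_seqP[l lr].
    have := avoiding_nodeP r (\max_(s <- l) level s).+1.
    set s := avoiding_node _ _ => sr.
    have sl : s \in l by have : [set s | avoids r s] s by []; rewrite lr.
    by have := leq_bigmax_seq (P := xpredT) (F := level) s sl isT; rewrite ltnn.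
  have [x /closure_codeP xP] := trace_infinite memberE inf.
  exists x => /=; have [s sr sx] := xP [:: inr (inl r)].
  by rewrite -sx ?mem_head.
have [k _ kx] := Dd _ Dx.
by have := rP k r (fun _ _ => erefl); rewrite kx xr.
Qed.

(** Finitely many flags take any prescribed values at nodes of arbitrarily large level; the level
    bound in [base] makes the filter free. *)
Lemma remainder_flags (y : (nat -> bool) -> bool) :
  exists x : K, forall c, set_val x (inr (inr c)) = y c.
Proof.
pose base (Nc : nat * seq (nat -> bool)) : set node :=
  [set s | (Nc.1 <= level s)%N /\ {in Nc.2, forall c, flag c s = y c}].
have FB : Filter (filter_from setT base).
  apply: filter_from_filter; first by exists (0%N, [::]).
  move=> [N cs] [M ds] _ _; exists (maxn N M, cs ++ ds) => // s [/= NM sy].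
  move: NM; rewrite geq_max => /andP[Ns Ms].
  by split; split=> //= c cc; apply: sy; rewrite mem_cat cc ?orbT.
have PB : ProperFilter (filter_from setT base).
  apply: filter_from_proper => -[N cs] _.
  have [M _ sepM] := near_separated cs.
  exists (flagged_node cs y (maxn N M)); split; first exact: leq_maxl.
  by apply: flagged_nodeP; apply: sepM; exact: leq_maxr.
have [a|x xB] := free_filter_trace memberE PB.
  exists ((level a).+1, [::]) => // s [/= sa _] sa'.
  by move: sa; rewrite sa' ltnn.
exists x => c.
have /closure_codeP/(_ [:: inr (inr c)])[s [_ /= sc] sx] :
    @trace _ _ member (base (0%N, [:: c])) x.
  by apply: xB; exists (0%N, [:: c]).
by rewrite -sx ?mem_head//=; apply: sc; rewrite mem_head.
Qed.

(** * A continuous map onto the unit cube *)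

Section CubeImage.
Variable R : realType.

(* The bits at the codes of [(q, j)], for rational [q], are the left cut of [r]
   if [j] is [k], and 0 otherwise. *)
Definition cut_code (rk : R * nat) : nat -> bool := fun n =>
  if unpickle n is Some (q, j) then (ratr q < rk.1) && (j == rk.2) else false.

(** A rational between two reals tells their cuts apart; for equal reals, a rational below them
    reveals the index. *)
Lemma cut_code_inj : injective cut_code.
Proof.
have lt_neq r k r' k' : r < r' -> cut_code (r, k) <> cut_code (r', k').
  move=> /rat_in_itvoo[q]; rewrite in_itv/= => /andP[rq qr'].
  move=> /(congr1 (fun c => c (pickle (q, k')))).
  by rewrite /cut_code pickleK/= qr' eqxx ltNge (ltW rq).
move=> [r k] [r' k'] cE.
have [rr'|r'r|rr'] := ltgtP r r'; first by case: (lt_neq _ _ _ _ rr' cE).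
  by case: (lt_neq _ _ _ _ r'r (esym cE)).
have /rat_in_itvoo[q] : r - 1 < r by rewrite ltrBlDr ltrDl.
rewrite in_itv/= => /andP[_ qr].
move: cE => /(congr1 (fun c => c (pickle (q, k)))).
by rewrite /cut_code pickleK/= -rr' qr eqxx/= => /esym/eqP <-.
Qed.

Local Notation unit_interval := (set_type (`[0, 1]%classic : set R)).

Lemma cantor_unit_interval : exists2 g : cantor_space -> unit_interval,
  continuous g & forall z, exists b, g b = z.
Proof.
have I0 : (`[0, 1]%classic : set R) 0 by rewrite /= in_itv/= lexx ler01.
pose T : pseudoPMetricType R := HB.pack unit_interval
  (isPointed.Build unit_interval (exist _ 0 (mem_set I0))).
have cT : compact [set: T] by apply: compact_set_type; exact: segment_compact.
have hT : hausdorff_space T by apply: hausdorff_set_type; exact: Rhausdorff.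
have [g cg] := cantor_surj cT hT.
exists g => // z; have [b _ bz] := 'surj_g (I : [set: T] z).
by exists b.
Qed.

(** Each real [r] owns the countably many flags [cut_code (r, k)], which spell a point of the Cantor
    space, and [g] maps that to the segment. Injectivity of [cut_code] lets all these points be
    chosen independently. *)
Lemma remainder_onto_cube (x0 : K) :
  exists2 f : pointed_remainder x0 -> unit_cube R,
    continuous f & range f = [set: unit_cube R].
Proof.
have [g cg gsurj] := cantor_unit_interval.
pose digits (r : R) (x : pointed_remainder x0) : cantor_space :=
  fun k => set_val x (inr (inr (cut_code (r, k)))).
exists (fun x r => g (digits r x)).
  apply: continuous_ptws => r x.
  apply: (@continuous_comp _ _ _ (digits r) g); last exact: cg.
  apply: continuous_ptws => k {}x.
  have cval : continuous (set_val : K -> {ptws coordinate -> bool}).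
    exact: initial_continuous.
  apply: (@continuous_comp _ _ _ set_val (fun q : {ptws coordinate -> bool} =>
    q (inr (inr (cut_code (r, k)))))); first exact: cval.
  exact: (@proj_continuous coordinate (fun=> bool)).
apply/seteqP; split=> // z _.
have /choice[b bz] r := gsurj (z r).
have [x xy] := remainder_flags
  (fun c => `[< exists rk, cut_code rk = c /\ b rk.1 rk.2 >]).
exists x => //; apply/funext => r; rewrite -bz; congr g; apply/funext => k.
rewrite /digits xy; apply/asboolP/idP => [[rk [/cut_code_inj ->]] //|bk].
by exists (r, k).
Qed.

End CubeImage.

Lemma node_bijection : exists e : nat -> node, bijective e.
Proof.
have level_inj : injective (avoiding_node (fun _ _ => true)).
  by move=> n k /(congr1 level).
have /infiniteP inf : infinite_set [set: node].
  move=> fin; apply: infinite_nat.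
  rewrite -(eq_finite_set (inj_card_eq (in2W level_inj))).
  exact: sub_finite_set fin.
have /card_set_bijP[f] : ([set: node] #= [set: nat])%card.
  by rewrite card_eq_le inf andbT; exact: countableP.
by rewrite setTT_bijective => -[e fK eK]; exists e, f.
Qed.

Theorem theorem5p7 (R : realType) :
  exists K : ptopologicalType,
    [/\ growth_of_omega K,
        ~ separable K,
        supports_measure R K
      & exists2 f : K -> unit_cube R,
          continuous f & range f = [set: unit_cube R]].
Proof.
have [x0 _] := remainder_flags (fun=> true).
have [e bij_e] := node_bijection.
have [m [m_ge0 mU m_fin m_low]] := limit_density R.
exists (pointed_remainder x0); split.
- exact: (remainder_growth memberE bij_e).
- exact: remainder_not_separable.
- apply: (@remainder_supports_measure _ _ _ _ memberE R m) => // F p W infW.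
  have [d d0 dW] := pattern_density R infW.
  exact: lt_le_trans d0 (m_low _ _ dW).
- exact: remainder_onto_cube.
Qed.
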